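(* Let $(M,\omega)$ be a symplectic manifold of dimension $2n$, let $1\le k\le n-1$, and let $\chi_1,\dots,\chi_{2k}\in C^\infty(M)$ be functions such that, at every point of $M$, $$\mathrm{d}\chi_1\wedge \mathrm{d}\chi_2\wedge\cdots\wedge \mathrm{d}\chi_{2k}\neq 0,\qquad \det\left(\{\chi_i,\chi_j\}\right)\neq 0 .$$ Then the Dirac bracket $\{\cdot,\cdot\}_D$ associated with $\chi_1,\dots,\chi_{2k}$ is defined (that is, uniquely determined) by the equation $$(n-k)\,(\mathrm{d}f\wedge \mathrm{d}g)\wedge \mathrm{d}\chi_1\wedge \mathrm{d}\chi_2\wedge\cdots\wedge \mathrm{d}\chi_{2k}\wedge\omega^{n-k-1}=\{f,g\}_D\,\mathrm{d}\chi_1\wedge \mathrm{d}\chi_2\wedge\cdots\wedge \mathrm{d}\chi_{2k}\wedge\omega^{n-k}$$ for all $f,g\in C^\infty(M)$.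
   Context: Powers of $\omega$ are wedge powers, $\omega^0=1$. The Poisson bracket $\{\cdot,\cdot\}$ of $(M,\omega)$ is $\{f,g\}=X_f(g)$, where $X_f$ is the hamiltonian vector field with $i_{X_f}\omega=-\mathrm{d}f$; in Darboux coordinates with $\omega=\sum_j \mathrm{d}p_j\wedge \mathrm{d}q_j$ it is $\{f,g\}=\sum_j\left(\frac{\partial f}{\partial p_j}\frac{\partial g}{\partial q_j}-\frac{\partial f}{\partial q_j}\frac{\partial g}{\partial p_j}\right)$. The Dirac bracket associated with $\chi_1,\dots,\chi_{2k}$ is $$\{f,g\}_D=\{f,g\}-\sum_{i,j=1}^{2k}\{f,\chi_i\}\,c_{ij}\,\{\chi_j,g\},$$ where $(c_{ij})$ is the inverse of the matrix $(\{\chi_i,\chi_j\})$. *)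

(* Defs.v *)
From HB Require Import structures.
From mathcomp Require Import all_boot all_order all_algebra perm.
From mathcomp Require Import zify.
From mathcomp Require Import all_classical all_reals all_analysis.
Set Implicit Arguments.
Unset Strict Implicit.
Unset Printing Implicit Defensive.
Import Order.TTheory GRing.Theory Num.Theory.
Import numFieldNormedType.Exports.
Local Open Scope classical_set_scope.
Local Open Scope ring_scope.

(* An exterior [k]-form is a function [('I_k -> V) -> R] satisfying
   [exterior_form]; the operations are defined on all such functions. *)
Notation "''Form[' R ]_ k V" := (('I_k -> V) -> (R : Type))
  (at level 8, k at level 2, V at level 8, format "''Form[' R ]_ k  V").

Section ExteriorForms.
Variables (R : realType) (V : lmodType R).
Implicit Types k l : nat.

Definition subst_arg k (v : 'I_k -> V) (i : 'I_k) (x : V) : 'I_k -> V :=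
  fun j => if j == i then x else v j.

Definition multilinear k (a : 'Form[R]_k V) : Prop :=
  forall (v : 'I_k -> V) (i : 'I_k) (c : R) (x y : V),
    a (subst_arg v i (c *: x + y)) =
    c * a (subst_arg v i x) + a (subst_arg v i y).

Definition alternating k (a : 'Form[R]_k V) : Prop :=
  forall (v : 'I_k -> V) (i j : 'I_k), i != j -> v i = v j -> a v = 0.

Definition exterior_form k (a : 'Form[R]_k V) : Prop :=
  multilinear a /\ alternating a.

(* Normalised so that (a /\ b)(x, y) = a x * b y - a y * b x on 1-forms. *)
Definition wedge k l (a : 'Form[R]_k V) (b : 'Form[R]_l V) :
    'Form[R]_(k + l) V :=
  fun v => ((k`! * l`!)%:R)^-1 *
    \sum_(s : 'S_(k + l)) (-1) ^+ s *
       (a (fun i => v (s (lshift l i))) * b (fun j => v (s (rshift k j)))).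

Definition form1 : 'Form[R]_0 V := fun=> 1.

Fixpoint wedge_list r : ('I_r -> 'Form[R]_1 V) -> 'Form[R]_r V :=
  match r return ('I_r -> 'Form[R]_1 V) -> 'Form[R]_r V with
  | 0 => fun=> form1
  | r'.+1 => fun a => wedge (a ord0) (wedge_list (fun i => a (lift ord0 i)))
  end.

Fixpoint wedge_pow (w : 'Form[R]_2 V) r : 'Form[R]_(r.*2) V :=
  match r return 'Form[R]_(r.*2) V with
  | 0 => form1
  | r'.+1 => wedge w (@wedge_pow w r')
  end.

Definition contract k (x : V) (a : 'Form[R]_k.+1 V) : 'Form[R]_k V :=
  fun v => a (fun i => if unlift ord0 i is Some j then v j else x).

Definition cast_form k l (e : k = l) (a : 'Form[R]_k V) : 'Form[R]_l V :=
  fun v => a (fun i => v (cast_ord e i)).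

Definition scale_form k (c : R) (a : 'Form[R]_k V) : 'Form[R]_k V :=
  fun v => c * a v.

Definition nondegenerate (w : 'Form[R]_2 V) : Prop :=
  forall x : V, (forall v, contract x w v = 0) -> x = 0.

End ExteriorForms.

(* For open [U] this is C^oo on [U]: all iterated directional derivatives
   exist and are (Frechet) differentiable at every point of [U]. *)
Definition smooth_on (R : realType) (m : nat) (W : normedModType R)
    (U : set 'rV[R]_m) (f : 'rV[R]_m -> W) : Prop :=
  forall (s : seq 'rV[R]_m) (x : 'rV[R]_m), U x ->
    differentiable (foldr (fun v g y => 'D_v g y) f s) x.

(* Values of [chart_map] outside [chart_dom], and of [chart_inv] outside
   [chart_img], are irrelevant. *)
Record chart (R : realType) (m : nat) (M : topologicalType) := Chart {
  chart_dom : set M;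
  chart_map :> M -> 'rV[R]_m;
  chart_inv : 'rV[R]_m -> M;
  chart_dom_open : open chart_dom;
  chart_img_open : open (chart_map @` chart_dom);
  chart_mapK : forall p, chart_dom p -> chart_inv (chart_map p) = p;
  chart_map_continuous : forall p, chart_dom p -> {for p, continuous chart_map};
  chart_inv_continuous : forall x, (chart_map @` chart_dom) x ->
    {for x, continuous chart_inv}
}.

Definition chart_img R m M (c : chart R m M) : set 'rV[R]_m :=
  c @` chart_dom c.

Record manifold (R : realType) (m : nat) := Manifold {
  mspace :> topologicalType;
  atlas : set (chart R m mspace);
  mspace_hausdorff : hausdorff_space mspace;
  mspace_second_countable : @second_countable mspace;
  atlas_cover : forall p, exists2 c, atlas c & chart_dom c p;
  atlas_compatible : forall c c', atlas c -> atlas c' ->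
    smooth_on (c @` (chart_dom c `&` chart_dom c')) (c' \o chart_inv c)
}.
Arguments atlas {R m} M : rename.

Record smooth_fun (R : realType) (m : nat) (M : manifold R m) := SmoothFun {
  sfun :> M -> R;
  sfun_smooth : forall c, atlas M c ->
    smooth_on (chart_img c) (sfun \o chart_inv c)
}.

Section Tangent.
Variables (R : realType) (m : nat) (M : manifold R m).
Implicit Types (p : M) (c : chart R m M).

Definition chart_at p c : Prop := atlas M c /\ chart_dom c p.

(* A tangent vector at [p] is the family of its component vectors in the charts
   around [p], related by the Jacobians of the changes of coordinates (and, for
   definiteness, 0 in the charts that do not contain [p]). *)
Definition is_tangent p (v : chart R m M -> 'rV[R]_m) : Prop :=
  (forall c, ~ chart_at p c -> v c = 0) /\
  (forall c c', chart_at p c -> chart_at p c' ->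
     v c' = 'd (c' \o chart_inv c) (c p) (v c)).

Definition tangent_pred p : {pred (chart R m M -> 'rV[R]_m)} :=
  fun v => `[< is_tangent p v >].

Lemma tangent_submod p : submod_closed (tangent_pred p).
Proof.
split; first by apply/asboolP; split=> // c c' _ _; rewrite linear0.
move=> a u v /asboolP[u0 uJ] /asboolP[v0 vJ]; apply/asboolP; split.
  move=> c nc; rewrite -[LHS]/(a *: u c + v c).
  by rewrite u0// v0// scaler0 addr0.
move=> c c' pc pc'; rewrite -[LHS]/(a *: u c' + v c').
by rewrite -[(a *: u + v) c]/(a *: u c + v c) linearP (uJ c c')// (vJ c c').
Qed.

HB.instance Definition _ p := GRing.isSubmodClosed.Build R
  (chart R m M -> 'rV[R]_m) (tangent_pred p) (tangent_submod p).

Record tangent p := Tangent {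
  components :> chart R m M -> 'rV[R]_m;
  components_tangent : components \in tangent_pred p
}.

HB.instance Definition _ p := [isSub for @components p].
HB.instance Definition _ p := [Choice of tangent p by <:].
HB.instance Definition _ p := [SubChoice_isSubLmodule of tangent p by <:].

Lemma pick_chart_subproof p : exists c, chart_at p c.
Proof. by have [c ac cp] := atlas_cover p; exists c. Qed.

Definition pick_chart p : chart R m M := projT1 (cid (pick_chart_subproof p)).

(* [df_p], a 1-form on the tangent space; by the transformation law of tangent
   vectors it does not depend on the chart used to compute it. *)
Definition dfun (f : M -> R) p : 'Form[R]_1 (tangent p) :=
  fun v => let c := pick_chart p in
           'd (f \o chart_inv c) (c p) (v ord0 c).

(* The tangent vector at [p] whose component vector in the chart [c] is [u]. *)
Definition coord_family c p (u : 'rV[R]_m) : chart R m M -> 'rV[R]_m :=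
  fun c' => if `[< chart_at p c' >] then 'd (c' \o chart_inv c) (c p) u else 0.

Definition coord_vector c p (u : 'rV[R]_m) : tangent p :=
  insubd (0 : tangent p) (coord_family c p u).

Lemma coord_family_tangent c p u : chart_at p c ->
  is_tangent p (coord_family c p u).
Proof.
move=> pc; split=> [c' npc'|c1 c2 pc1 pc2].
  by rewrite /coord_family asboolF.
rewrite /coord_family !asboolT//.
case: pc pc1 pc2 => ac cp [ac1 c1p] [ac2 c2p].
have E : chart_inv c (c p) = p by exact: chart_mapK.
have d1 : differentiable (c1 \o chart_inv c) (c p).
  by have /(_ [::] (c p)) := atlas_compatible ac ac1; apply; exists p.
have d2 : differentiable (c2 \o chart_inv c1) ((c1 \o chart_inv c) (c p)).
  by rewrite /= E; have /(_ [::] (c1 p)) := atlas_compatible ac1 ac2; apply; exists p.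
have d12 : differentiable (c2 \o chart_inv c) (c p).
  by have /(_ [::] (c p)) := atlas_compatible ac ac2; apply; exists p.
have e2 : 'd (c2 \o chart_inv c1) ((c1 \o chart_inv c) (c p)) =
          'd (c2 \o chart_inv c1) (c1 p) :> (_ -> _) by rewrite /= E.
apply: etrans (esym (deriveE u d12)) _.
apply: etrans; last first.
  apply: etrans (deriveE u (differentiable_comp d1 d2)) _.
  apply: etrans (congr1 (fun h : _ -> _ => h u) (diff_comp d1 d2)) _.
  exact: (congr1 (fun h : _ -> _ => h _) e2).
apply: near_eq_derive.
have nc1 : nbhs p (chart_dom c1).
  exact: (open_nbhs_nbhs (conj (chart_dom_open c1) c1p)).
have {}nc1 := eq_ind_r (fun q => nbhs q (chart_dom c1)) nc1 E.
have imgcp : (c @` chart_dom c) (c p) by exists p.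
have : nbhs (c p) [set y | chart_dom c1 (chart_inv c y)].
  exact: chart_inv_continuous imgcp _ nc1.
by apply: filterS => y c1y /=; rewrite chart_mapK.
Qed.

End Tangent.

Arguments wedge_pow {R V} w r.
Arguments wedge_list {R V r} a.
Arguments coord_vector {R m M} c p u.
Arguments dfun {R m M} f p v.

Section DifferentialForms.
Variables (R : realType) (m : nat) (M : manifold R m).

(* The coefficient of [w] along the coordinate vector fields of the chart [c]
   with constant components [u 0], ..., [u (k - 1)], read in the chart. *)
Definition coefficient k (w : forall p : M, 'Form[R]_k (tangent p))
    (c : chart R m M) (u : 'I_k -> 'rV[R]_m) (x : 'rV[R]_m) : R :=
  w (chart_inv c x) (fun i => coord_vector c (chart_inv c x) (u i)).

Record diff_form k := DiffForm {
  dform :> forall p : M, 'Form[R]_k (tangent p);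
  dform_exterior : forall p, exterior_form (@dform p);
  dform_smooth : forall c, atlas M c -> forall u,
    smooth_on (chart_img c) (coefficient (@dform) c u)
}.

Arguments dform {k} w p : rename.

(* The coefficients, in the chart [c], of the exterior derivative of [w]; the
   coordinate vector fields commute, so no Lie bracket occurs. *)
Definition d_coefficient k (w : diff_form k) (c : chart R m M)
    (u : 'I_k.+1 -> 'rV[R]_m) (x : 'rV[R]_m) : R :=
  \sum_(i < k.+1)
    (-1) ^+ i * 'D_(u i) (coefficient w c (fun j => u (lift i j))) x.

Definition closed_form k (w : diff_form k) : Prop :=
  forall c, atlas M c -> forall u x, chart_img c x -> d_coefficient w c u x = 0.

End DifferentialForms.

Record symplectic_manifold (R : realType) (n : nat) := SymplecticManifold {
  smanifold :> manifold R n.*2;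
  omega : diff_form smanifold 2;
  omega_closed : closed_form omega;
  omega_nondegenerate : forall p, nondegenerate (omega p)
}.

Section PoissonDirac.
Variables (R : realType) (n : nat) (M : symplectic_manifold R n).

(* [X_f] at [p]: the unique [X] such that [i_X omega = - df] at [p]; it exists
   because [omega] is nondegenerate and tangent spaces have finite dimension. *)
Definition hamiltonian (f : M -> R) (p : M) : tangent p :=
  xget 0 [set X : tangent p | contract X (omega M p) = (fun v => - dfun f p v)].

Definition poisson_bracket (f g : M -> R) (p : M) : R :=
  dfun g p (fun=> hamiltonian f p).

Definition poisson_matrix r (chi : 'I_r -> smooth_fun M) (p : M) : 'M[R]_r :=
  \matrix_(i, j) poisson_bracket (chi i) (chi j) p.

Definition dirac_bracket r (chi : 'I_r -> smooth_fun M) (f g : smooth_fun M) (p : M) :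
    R :=
  poisson_bracket f g p -
  \sum_(i < r) \sum_(j < r)
     poisson_bracket f (chi i) p * invmx (poisson_matrix chi p) i j *
     poisson_bracket (chi j) g p.

Definition d_list r (chi : 'I_r -> smooth_fun M) (p : M) :
    'Form[R]_r (tangent p) :=
  wedge_list (fun i => dfun (chi i) p).
Arguments d_list {r} chi p.

Lemma dirac_degree k : (1 <= k <= n - 1)%N ->
  (1 + 1 + k.*2 + (n - k - 1).*2 = k.*2 + (n - k).*2)%N.
Proof. lia. Qed.

(* [cast_form] only identifies the two expressions of the degree [2 n]. *)
Definition dirac_equation k (hk : (1 <= k <= n - 1)%N)
    (chi : 'I_(k.*2) -> smooth_fun M) (f g : smooth_fun M) (h : M -> R) : Prop :=
  forall p : M,
    cast_form (dirac_degree hk)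
      (scale_form (n - k)%:R
        (wedge (wedge (wedge (dfun f p) (dfun g p)) (d_list chi p))
               (wedge_pow (omega M p) (n - k - 1)))) =
    scale_form (h p) (wedge (d_list chi p) (wedge_pow (omega M p) (n - k))).

End PoissonDirac.
Arguments d_list {R n M r} chi p.

(* Main.v *)
From HB Require Import structures.
Require Import Defs.
From mathcomp Require Import all_boot all_order all_algebra perm zify ring.
From mathcomp Require Import all_classical all_reals all_analysis.
Set Implicit Arguments.
Unset Strict Implicit.
Unset Printing Implicit Defensive.
Import Order.TTheory GRing.Theory Num.Theory.
Import numFieldNormedType.Exports.
Local Open Scope classical_set_scope.
Local Open Scope ring_scope.

(** The equation is pointwise, so it is a statement about a symplectic vector
    space of dimension [N = 2n] (a tangent space) and the hamiltonian vectors
    [a], [b], [x_1], ..., [x_2k] of [f], [g] and the [chi_i].  Write [x^] for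
    the 1-form [- i_x w], so that [df = a^] and [{f, g} = w(a, b)].

    Suppose first that [a] is orthogonal to the [x_i].  The form
    [b^ /\ x_1^ /\ ... /\ x_2k^ /\ w^(n-k)] has degree [2n + 1], hence is zero.
    Contracting it with [a] and using [i_a w = - a^] gives
<<
    w(a, b) x_1^ /\ ... /\ x_2k^ /\ w^(n-k)
      = (n-k) a^ /\ b^ /\ x_1^ /\ ... /\ x_2k^ /\ w^(n-k-1)
>>
    ([wedge_power_identity]).  For an arbitrary [a], subtract its projection
    on the span of the [x_i] along the orthogonal complement, which exists
    because the Gram matrix [w(x_i, x_j)] is invertible.  This does not change
    the right-hand side, and turns [w(a, b)] into the Dirac bracket
    ([dirac_identity]).

    For uniqueness, [x_1^ /\ ... /\ x_2k^ /\ w^(n-k)] must not vanish.  The same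
    identity, read from right to left, reduces this to the case where no
    factor [w] is left ([wedge_power_neq0]): add to the [x_i] two vectors [a],
    [b] of the orthogonal complement with [w(a, b) != 0], and repeat.  The
    product of 1-forms so extended stays nonzero, as the product of the
    [d chi_i] is.

    The calculations take place in the algebra of cochains: functions of a
    finite sequence of vectors of any length, that is, sums of forms of all
    degrees.  There the product can be defined by recursion on the sequence of
    vectors, contraction being an antiderivation by definition.  Associativity
    and graded commutativity then follow by induction, and no identification
    of degrees such as [(k + l) + m = k + (l + m)] is ever needed.
    [cochain_of_wedge] shows that on alternating forms this product is the
    normalised sum over permutations. *)

(** * The shuffle algebra of cochains *)

Section Shuffle.
Variables (R : numFieldType) (V : lmodType R).
Local Notation cochain := (seq V -> R).
Implicit Types (a b c : cochain) (x y : V) (s t : seq V).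

(** Interior product with [x]. *)
Definition iprod x a : cochain := fun s => a (x :: s).

(** The main involution of the exterior algebra; it carries the Koszul sign
    of moving a contraction past [a]. *)
Definition grading a : cochain := fun s => (-1) ^+ size s * a s.

Definition homogeneous k a := forall s, size s != k -> a s = 0.

(** The exterior product, defined by letting the contraction with the first
    vector act as an antiderivation.  Unfolded, it is the sum over the
    shuffles of the arguments, with no factorials, and it makes sense for
    arbitrary cochains; alternation only matters when it is compared with the
    sum over all permutations. *)
Fixpoint shuffle_at s a b : R :=
  if s is x :: s' then
    shuffle_at s' (iprod x a) b + shuffle_at s' (grading a) (iprod x b)
  else a [::] * b [::].
Definition shuffle a b : cochain := fun s => shuffle_at s a b.

Definition unit_cochain : cochain := fun s => (s == [::])%:R.

Lemma iprod_shuffle x a b :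
  iprod x (shuffle a b) =
  fun s => shuffle (iprod x a) b s + shuffle (grading a) (iprod x b) s.
Proof. by []. Qed.

Lemma shuffle_cons a b x s :
  shuffle a b (x :: s) =
  shuffle (iprod x a) b s + shuffle (grading a) (iprod x b) s.
Proof. by []. Qed.

Lemma gradingK a : grading (grading a) = a.
Proof. by apply/funext => s; rewrite /grading mulrA -expr2 sqrr_sign mul1r. Qed.

Lemma iprod_grading x a :
  iprod x (grading a) = fun s => - grading (iprod x a) s.
Proof. by apply/funext => s; rewrite /iprod /grading /= exprS !mulN1r mulNr. Qed.

Lemma grading_linear z a a' :
  grading (fun s => z * a s + a' s) = fun s => z * grading a s + grading a' s.
Proof. by apply/funext => s; rewrite /grading; ring. Qed.

Lemma shuffle_linearl z a a' b :
  shuffle (fun s => z * a s + a' s) b =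
  fun s => z * shuffle a b s + shuffle a' b s.
Proof.
apply/funext => s; rewrite /shuffle.
elim: s a a' b => [|x s IH] a a' b /=; first by ring.
by rewrite grading_linear !IH; ring.
Qed.

Lemma shuffle_linearr z a b b' :
  shuffle a (fun s => z * b s + b' s) =
  fun s => z * shuffle a b s + shuffle a b' s.
Proof.
apply/funext => s; rewrite /shuffle.
elim: s a b b' => [|x s IH] a b b' /=; first by ring.
by rewrite !IH; ring.
Qed.

Lemma shuffleDl a a' b :
  shuffle (fun s => a s + a' s) b = fun s => shuffle a b s + shuffle a' b s.
Proof.
have := shuffle_linearl 1 a a' b.
have -> : (fun s => 1 * a s + a' s) = fun s => a s + a' s.
  by apply/funext => s; rewrite mul1r.
by move->; apply/funext => s; rewrite mul1r.
Qed.

Lemma shuffleDr a b b' :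
  shuffle a (fun s => b s + b' s) = fun s => shuffle a b s + shuffle a b' s.
Proof.
have := shuffle_linearr 1 a b b'.
have -> : (fun s => 1 * b s + b' s) = fun s => b s + b' s.
  by apply/funext => s; rewrite mul1r.
by move->; apply/funext => s; rewrite mul1r.
Qed.

Lemma shuffle0l b : shuffle (fun=> 0) b = fun=> 0.
Proof.
have := shuffle_linearl (-1) (fun=> 0) (fun=> 0) b.
have -> : (fun _ : seq V => -1 * (0 : R) + 0) = fun=> 0.
  by apply/funext => s; ring.
by move=> E; apply/funext => s; rewrite E mulN1r addNr.
Qed.

Lemma shuffle0r a : shuffle a (fun=> 0) = fun=> 0.
Proof.
have := shuffle_linearr (-1) a (fun=> 0) (fun=> 0).
have -> : (fun _ : seq V => -1 * (0 : R) + 0) = fun=> 0.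
  by apply/funext => s; ring.
by move=> E; apply/funext => s; rewrite E mulN1r addNr.
Qed.

Lemma shuffleZl z a b :
  shuffle (fun s => z * a s) b = fun s => z * shuffle a b s.
Proof.
transitivity (shuffle (fun s => z * a s + 0) b).
  by congr shuffle; apply/funext => s; rewrite addr0.
rewrite (shuffle_linearl z a (fun=> 0)) shuffle0l.
by apply/funext => s; rewrite addr0.
Qed.

Lemma shuffleZr z a b :
  shuffle a (fun s => z * b s) = fun s => z * shuffle a b s.
Proof.
transitivity (shuffle a (fun s => z * b s + 0)).
  by congr shuffle; apply/funext => s; rewrite addr0.
rewrite (shuffle_linearr z a b (fun=> 0)) shuffle0r.
by apply/funext => s; rewrite addr0.
Qed.

Lemma shuffleNr a b : shuffle a (fun s => - b s) = fun s => - shuffle a b s.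
Proof.
transitivity (shuffle a (fun s => -1 * b s)).
  by congr shuffle; apply/funext => s; rewrite mulN1r.
by rewrite shuffleZr; apply/funext => s; rewrite mulN1r.
Qed.

Lemma shuffleNl a b : shuffle (fun s => - a s) b = fun s => - shuffle a b s.
Proof.
transitivity (shuffle (fun s => -1 * a s) b).
  by congr shuffle; apply/funext => s; rewrite mulN1r.
by rewrite shuffleZl; apply/funext => s; rewrite mulN1r.
Qed.

Lemma grading_shuffle a b :
  grading (shuffle a b) = shuffle (grading a) (grading b).
Proof.
apply/funext => s; elim: s a b => [|x s IH] a b.
  by rewrite /grading /shuffle /= !mul1r.
rewrite shuffle_cons -[LHS]/(iprod x (grading (shuffle a b)) s).
rewrite iprod_grading iprod_shuffle !iprod_grading shuffleNl shuffleNr.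
by rewrite -!IH /grading mulrDr opprD.
Qed.

(** Both sides satisfy the same recursion: contracting with the first vector
    gives three terms, according to the factor that receives it. *)
Lemma shuffleA a b c : shuffle (shuffle a b) c = shuffle a (shuffle b c).
Proof.
apply/funext => s; elim: s a b c => [|x s IH] a b c.
  by rewrite /shuffle /= mulrA.
rewrite !shuffle_cons !iprod_shuffle grading_shuffle.
by rewrite shuffleDl shuffleDr !IH addrA.
Qed.

Lemma homogeneous_grading k a :
  homogeneous k a -> grading a = fun s => (-1) ^+ k * a s.
Proof.
move=> ha; apply/funext => s; rewrite /grading.
by have [->//|/ha ->] := eqVneq (size s) k; rewrite !mulr0.
Qed.

Lemma homogeneous_iprod k x a :
  homogeneous k a -> homogeneous k.-1 (iprod x a).
Proof. by move=> ha s sk; apply: ha => /=; lia. Qed.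

Lemma homogeneous0_iprod x a : homogeneous 0 a -> iprod x a = fun=> 0.
Proof. by move=> ha; apply/funext => s; exact: ha. Qed.

Lemma homogeneous_shuffle k l a b :
  homogeneous k a -> homogeneous l b -> homogeneous (k + l) (shuffle a b).
Proof.
move=> ha hb s; elim: s k l a b ha hb => [|x s IH] k l a b ha hb sz.
  rewrite /shuffle /=; case: k l ha hb sz => [|k] [|l] ha hb sz //.
  - by rewrite (hb [::])// mulr0.
  - by rewrite (ha [::])// mul0r.
  - by rewrite (ha [::])// mul0r.
rewrite shuffle_cons.
rewrite (homogeneous_grading ha) shuffleZl.
have -> : shuffle (iprod x a) b s = 0.
  case: k ha sz => [|k] ha sz; first by rewrite homogeneous0_iprod// shuffle0l.
  by apply: (IH k l); [exact: homogeneous_iprod ha|exact: hb|move: sz => /=; lia].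
suff -> : shuffle a (iprod x b) s = 0 by rewrite mulr0 addr0.
case: l hb sz => [|l] hb sz; first by rewrite homogeneous0_iprod// shuffle0r.
by apply: (IH k l); [exact: ha|exact: homogeneous_iprod hb|move: sz => /=; lia].
Qed.

(** Graded commutativity.  Only the parities of the factors enter, and they
    are recorded as eigenvalues of [grading] since a contraction just flips
    them. *)
Lemma shuffleC (p q : nat) a b :
  grading a = (fun s => (-1) ^+ p * a s) ->
  grading b = (fun s => (-1) ^+ q * b s) ->
  shuffle a b = fun s => (-1) ^+ (p * q) * shuffle b a s.
Proof.
move=> ga gb; apply/funext => s; elim: s p q a b ga gb => [|x s IH] p q a b ga gb.
  rewrite /shuffle /=.
  move: (congr1 (@^~ [::]) ga) (congr1 (@^~ [::]) gb).
  rewrite /grading /= !mul1r -(signr_odd _ p) -(signr_odd _ q).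
  rewrite -(signr_odd _ (p * q)) oddM => Ea Eb.
  case: (odd p) Ea => Ea; last by rewrite mul1r mulrC.
  case: (odd q) Eb => Eb; last by rewrite mul1r mulrC.
  (* An odd cochain vanishes on the empty sequence. *)
  have -> : a [::] = 0.
    by move/eqP: Ea; rewrite mulN1r -addr_eq0 -mulr2n mulrn_eq0 /= => /eqP.
  by rewrite mulr0 mul0r mulr0.
have gi r d : grading d = (fun s => (-1) ^+ r * d s) ->
    grading (iprod x d) = fun s => (-1) ^+ r.+1 * iprod x d s.
  move=> gd; apply/funext => t.
  have := congr1 (@^~ (x :: t)) gd; rewrite /grading /iprod /= !exprS.
  by move=> E; rewrite -mulrA -E; ring.
rewrite shuffle_cons.
rewrite shuffle_cons.
rewrite ga gb !shuffleZl (IH _ _ _ _ (gi _ _ ga) gb) (IH _ _ _ _ ga (gi _ _ gb)).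
rewrite mulrDr addrC !mulrA -!exprD.
have sgn i j : odd i = odd j -> (-1) ^+ i = (-1) ^+ j :> R.
  by move=> E; rewrite -signr_odd E signr_odd.
rewrite (sgn (p + p * q.+1)%N (p * q)%N); last first.
  by rewrite oddD !oddM /=; case: (odd p); case: (odd q).
rewrite (sgn (p.+1 * q)%N (p * q + q)%N) //.
by rewrite oddD !oddM /=; case: (odd p); case: (odd q).
Qed.

Lemma shuffle1l b : shuffle unit_cochain b = b.
Proof.
apply/funext => s; elim: s b => [|x s IH] b; first by rewrite /shuffle /= mul1r.
rewrite shuffle_cons.
have h1 : homogeneous 0 unit_cochain by case.
rewrite (homogeneous_grading h1) shuffleZl mul1r IH.
by rewrite homogeneous0_iprod// shuffle0l add0r.
Qed.

Lemma shuffle1r a : shuffle a unit_cochain = a.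
Proof.
apply/funext => s; elim: s a => [|x s IH] a; first by rewrite /shuffle /= mulr1.
rewrite shuffle_cons.
have h1 : homogeneous 0 unit_cochain by case.
by rewrite [iprod x unit_cochain]homogeneous0_iprod// shuffle0r addr0 IH.
Qed.

Definition mlinear a := forall s x y z t,
  a (s ++ (z *: x + y) :: t) = z * a (s ++ x :: t) + a (s ++ y :: t).

Definition antisym a := forall s x y t,
  a (s ++ x :: y :: t) = - a (s ++ y :: x :: t).

Lemma mlinear_iprod x a : mlinear a -> mlinear (iprod x a).
Proof. by move=> la s; exact: (la (x :: s)). Qed.

Lemma mlinear_grading a : mlinear a -> mlinear (grading a).
Proof. by move=> la s x y z t; rewrite /grading la !size_cat /=; ring. Qed.

Lemma antisym_iprod x a : antisym a -> antisym (iprod x a).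
Proof. by move=> la s; exact: (la (x :: s)). Qed.

Lemma antisym_grading a : antisym a -> antisym (grading a).
Proof. by move=> la s x y t; rewrite /grading la !size_cat /=; ring. Qed.

Lemma mlinear_shuffle a b : mlinear a -> mlinear b -> mlinear (shuffle a b).
Proof.
move=> la lb s; elim: s a b la lb => [|x0 s IH] a b la lb x y z t.
  rewrite !cat0s !shuffle_cons.
  have E d : mlinear d ->
      iprod (z *: x + y) d = fun s => z * iprod x d s + iprod y d s.
    by move=> ld; apply/funext => u; exact: (ld [::]).
  by rewrite !E// shuffle_linearl shuffle_linearr; ring.
rewrite !cat_cons !shuffle_cons.
rewrite IH ?[X in _ + X]IH//; first by ring.
- exact: mlinear_grading.
- exact: mlinear_iprod.
- exact: mlinear_iprod.
Qed.

(** In the first two slots the mixed terms cancel because [grading]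
    anticommutes with contraction; the other slots follow by contracting. *)
Lemma antisym_shuffle a b : antisym a -> antisym b -> antisym (shuffle a b).
Proof.
move=> la lb s; elim: s a b la lb => [|x0 s IH] a b la lb x y t.
  have E u v : shuffle a b (u :: v :: t) =
     shuffle (iprod v (iprod u a)) b t + shuffle (grading (iprod u a)) (iprod v b) t
     - shuffle (grading (iprod v a)) (iprod u b) t + shuffle a (iprod v (iprod u b)) t.
    by rewrite !shuffle_cons gradingK iprod_grading shuffleNl addrA.
  have F d u v : antisym d ->
      iprod u (iprod v d) = fun s => -1 * iprod v (iprod u d) s.
    by move=> ld; apply/funext => w; rewrite mulN1r; exact: (ld [::]).
  by rewrite !cat0s !E (F a x y la) (F b x y lb) shuffleZl shuffleZr; ring.
rewrite !cat_cons !shuffle_cons IH ?[X in _ + X]IH//; first by ring.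
- exact: antisym_grading.
- exact: antisym_iprod.
- exact: antisym_iprod.
Qed.

Lemma antisym_front a s x t : antisym a ->
  a (s ++ x :: t) = (-1) ^+ size s * a (x :: s ++ t).
Proof.
elim: s a => [|y s IH] a sa /=; first by rewrite mul1r.
rewrite -[LHS]/(iprod y a (s ++ x :: t)) IH; last exact: antisym_iprod.
by rewrite exprS /iprod (sa [::] y x); ring.
Qed.

Lemma antisym_repeat a x s : antisym a -> x \in s -> a (x :: s) = 0.
Proof.
move=> sa /splitPr[p q].
rewrite -[LHS]/(iprod x a (p ++ x :: q)) antisym_front; last exact: antisym_iprod.
rewrite /iprod; have /eqP := sa [::] x x (p ++ q).
by rewrite -addr_eq0 -mulr2n mulrn_eq0 /= => /eqP ->; rewrite mulr0.
Qed.

End Shuffle.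

(** * Sums over permutations and shuffles *)

Lemma size_map_enum (T : Type) N (w : 'I_N -> T) :
  size [seq w i | i <- enum 'I_N] = N.
Proof. by rewrite size_map size_enum_ord. Qed.

Lemma nth_map_enum (T : Type) x0 N (w : 'I_N -> T) i (iN : (i < N)%N) :
  nth x0 [seq w i | i <- enum 'I_N] i = w (Ordinal iN).
Proof.
rewrite (nth_map (Ordinal iN)) ?size_enum_ord//; congr w.
by apply: val_inj; rewrite /= nth_enum_ord.
Qed.

Lemma map_enum_insert (T : Type) N (w : 'I_N.+1 -> T) (j : 'I_N.+1) :
  let t := [seq w (lift j i) | i <- enum 'I_N] in
  [seq w i | i <- enum 'I_N.+1] = take j t ++ w j :: drop j t.
Proof.
move=> t; have st : size t = N := size_map_enum _.
have jN : (j <= N)%N by rewrite -ltnS.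
apply: (@eq_from_nth _ (w j)) => [|i].
  by rewrite size_map_enum size_cat /= size_takel ?st// size_drop st; lia.
rewrite size_map_enum => iN; rewrite nth_map_enum.
rewrite nth_cat size_takel ?st//=; case: ltngtP => ij.
- have iN' : (i < N)%N by lia.
  rewrite nth_take// /t nth_map_enum; congr w.
  by apply: val_inj; rewrite /= /bump leqNgt ij.
- have iN' : (i.-1 < N)%N by lia.
  have -> : (i - j = (i.-1 - j).+1)%N by lia.
  rewrite /= nth_drop (_ : (j + (i.-1 - j) = i.-1)%N); last by lia.
  rewrite /t nth_map_enum; congr w.
  by apply: val_inj; rewrite /= /bump; lia.
- have -> : Ordinal iN = j by exact: val_inj.
  by rewrite ij subnn.
Qed.

(** A permutation of [0..N] is determined by the position [j] sent to 0 and the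
    permutation it induces on what remains. *)
Lemma sum_perm_lift (R : nmodType) N (F : 'S_N.+1 -> R) :
  \sum_s F s = \sum_(j < N.+1) \sum_(s : 'S_N) F (lift_perm j ord0 s).
Proof.
rewrite pair_big /=; apply: reindex.
pose h (p : 'I_N.+1 * 'S_N) := lift_perm p.1 ord0 p.2.
have inj_h : injective h.
  move=> [j s] [j' s'] /permP E; have jj' : j = j'.
    apply: (@perm_inj _ (h (j, s))); rewrite [RHS]E.
    by rewrite [LHS]lift_perm_id [RHS]lift_perm_id.
  move: E; rewrite -{}jj' => E; congr pair; apply/permP => i.
  by apply: (@lift_inj _ ord0); have := E (lift j i); rewrite /h !lift_perm_lift.
apply: onW_bij; apply: inj_card_bij inj_h _.
by rewrite card_prod card_ord !card_Sn factS.
Qed.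

Section PermSum.
Variables (R : numFieldType) (V : lmodType R).
Implicit Types (a b : seq V -> R).

(** The sum over all permutations counts every shuffle [k! (N - k)!] times.
    Group the permutations [s] by the position [j] with [s j = 0], that is, by
    the slot receiving the first vector.  Moving that vector to the front of
    its factor costs a sign that cancels the sign of [j], up to [(-1)^k] when
    it sits in the second factor.  So the [k] positions of the first block
    contribute equally, and so do the [N + 1 - k] others: this is the
    antiderivation rule defining [shuffle]. *)
Lemma sum_perm_shuffle N k a b (v : 'I_N -> V) : (k <= N)%N ->
  antisym a -> antisym b -> homogeneous k a -> homogeneous (N - k)%N b ->
  \sum_(s : 'S_N) (-1) ^+ s *
     (a (take k [seq v (s i) | i <- enum 'I_N]) *
      b (drop k [seq v (s i) | i <- enum 'I_N])) =
  (k`! * (N - k)`!)%:R * shuffle a b [seq v i | i <- enum 'I_N].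
Proof.
elim: N k a b v => [|N IH] k a b v.
  rewrite leqn0 => /eqP -> _ _ _ _.
  have e : enum 'I_0 = [::] by apply: size0nil; rewrite size_enum_ord.
  rewrite (bigD1 (1%g : 'S_0))//= big1 ?addr0 => [|s].
    by rewrite odd_perm1 e /shuffle /= !mul1r.
  by move/eqP=> []; apply/permP; case.
move=> kN sa sb ha hb.
pose v' i := v (lift ord0 i).
rewrite sum_perm_lift.
have step (j : 'I_N.+1) : \sum_(s : 'S_N) (-1) ^+ lift_perm j ord0 s *
     (a (take k [seq v (lift_perm j ord0 s i) | i <- enum 'I_N.+1]) *
      b (drop k [seq v (lift_perm j ord0 s i) | i <- enum 'I_N.+1])) =
    if (j < k)%N then (k.-1`! * (N.+1 - k)`!)%:R *
         shuffle (iprod (v ord0) a) b [seq v' i | i <- enum 'I_N]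
    else (-1) ^+ k * ((k`! * (N - k)`!)%:R *
         shuffle a (iprod (v ord0) b) [seq v' i | i <- enum 'I_N]).
  under eq_bigr => s _.
    rewrite (map_enum_insert _ j) lift_perm_id odd_lift_perm /=.
    under eq_map => i do rewrite lift_perm_lift -[v _]/(v' (s i)).
    over.
  have sz (s : 'S_N) : size [seq v' (s i) | i <- enum 'I_N] = N.
    exact: size_map_enum.
  have jN : (j <= N)%N by rewrite -ltnS.
  case: ltnP => jk.
    (* The first vector falls in the first block, at position [j]. *)
    have kN' : (k.-1 <= N)%N by lia.
    have eqN : (N - k.-1 = N.+1 - k)%N by lia.
    rewrite -eqN -IH//; last 3 first.
    - exact: antisym_iprod.
    - exact: homogeneous_iprod.
    - by rewrite eqN.
    apply: eq_bigr => s _; move: (sz s); set t := [seq _ | i <- _] => st.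
    have -> : take k (take j t ++ v ord0 :: drop j t) =
        take j (take k.-1 t) ++ v ord0 :: drop j (take k.-1 t).
      rewrite take_cat size_takel ?st//; case: ltnP => [|_]; first by lia.
      have -> : (k - j = (k.-1 - j).+1)%N by lia.
      rewrite /= take_takel; last by lia.
      by rewrite take_drop subnK//; lia.
    have -> : drop k (take j t ++ v ord0 :: drop j t) = drop k.-1 t.
      rewrite drop_cat size_takel ?st//; case: ltnP => [|_]; first by lia.
      have -> : (k - j = (k.-1 - j).+1)%N by lia.
      by rewrite /= drop_drop; congr (drop _ _); lia.
    rewrite antisym_front// cat_take_drop size_take size_takel ?st//.
    have -> : (if (j < k.-1)%N then nat_of_ord j else k.-1) = j by case: ltnP => ?; lia.
    rewrite /iprod addbF signr_addb signr_odd.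
    by rewrite -!mulrA mulrCA; congr (_ * _); rewrite !mulrA -expr2 sqrr_sign mul1r.
  (* The first vector falls in the second block, at position [j - k]. *)
  have kN' : (k <= N)%N by lia.
  rewrite -IH//; last 2 first.
  - exact: antisym_iprod.
  - by have := homogeneous_iprod (v ord0) hb; rewrite subSn.
  rewrite mulr_sumr; apply: eq_bigr => s _; move: (sz s).
  set t := [seq _ | i <- _] => st.
  have -> : take k (take j t ++ v ord0 :: drop j t) = take k t.
    rewrite take_cat size_takel ?st//; case: ltnP => jk'.
      by rewrite take_takel.
    have -> : nat_of_ord j = k by lia.
    by rewrite subnn cats0.
  have -> : drop k (take j t ++ v ord0 :: drop j t) =
      take (j - k) (drop k t) ++ v ord0 :: drop (j - k) (drop k t).
    rewrite drop_drop subnK// take_drop subnK//.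
    rewrite drop_cat size_takel ?st//; case: ltnP => jk' //.
    have -> : nat_of_ord j = k by lia.
    by rewrite subnn drop0 (@drop_oversize _ _ (take _ _)) ?size_takel ?st.
  rewrite antisym_front// cat_take_drop size_takel ?size_drop ?st; last by lia.
  rewrite /iprod addbF signr_addb signr_odd.
  rewrite -[X in (-1) ^+ X * _ * _](subnK jk) exprD.
  have : (-1) ^+ (j - k) * (-1) ^+ (j - k) = 1 :> R by rewrite -expr2 sqrr_sign.
  move: (_ ^+ (j - k)) (_ ^+ k) (_ ^+ s) (a _) (b _) => z p q A B zz.
  by transitivity (z * z * (p * (q * (A * B)))); [ring | rewrite zz mul1r].
under eq_bigr => j _ do rewrite step.
set X := _ * shuffle (iprod _ a) b _; set Y := (-1) ^+ k * _.
rewrite -(big_mkord xpredT (fun j => if (j < k)%N then X else Y)).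
rewrite (big_cat_nat (leq0n k) kN)/=.
rewrite (@eq_big_nat _ _ _ 0 k _ (fun=> X)) => [|i /andP[_ ->]]//.
rewrite (@eq_big_nat _ _ _ k N.+1 _ (fun=> Y)) => [|i /andP[+ _]]; last first.
  by rewrite leqNgt => /negPf ->.
rewrite !sumr_const_nat subn0 /X /Y.
have -> : [seq v i | i <- enum 'I_N.+1] = v ord0 :: [seq v' i | i <- enum 'I_N].
  by rewrite enum_ordSl /= -map_comp.
rewrite shuffle_cons (homogeneous_grading ha) shuffleZl mulrDr; congr (_ + _).
  case: (k) ha => [|k'] ha'.
    by rewrite homogeneous0_iprod// shuffle0l !mulr0.
  by rewrite -mulrnAl -mulr_natl -natrM mulnA -factS.
have [kN1|kN1] := eqVneq k N.+1.
  have hb0 : homogeneous 0 b by move: hb; rewrite kN1 subnn.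
  by rewrite kN1 subnn mulr0n (homogeneous0_iprod _ hb0) shuffle0r !mulr0.
have -> : (N.+1 - k = (N - k).+1)%N by lia.
rewrite -mulrnAr -mulrnAl -mulr_natl -natrM mulrCA.
by congr (_%:R * _); rewrite factS mulnCA.
Qed.

End PermSum.

Section Bridge.
Variables (R : realType) (V : lmodType R).

(** The default value 0 of [nth] is never reached, the size being [k]. *)
Definition cochain_of k (a : 'Form[R]_k V) : seq V -> R :=
  fun s => if size s == k then a (fun i => nth 0 s i) else 0.

Lemma cochain_of_homogeneous k (a : 'Form[R]_k V) : homogeneous k (cochain_of a).
Proof. by move=> s /negPf sk; rewrite /cochain_of sk. Qed.

Lemma cochain_ofE k (a : 'Form[R]_k V) v :
  cochain_of a [seq v i | i <- enum 'I_k] = a v.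
Proof.
rewrite /cochain_of size_map_enum eqxx; congr a; apply/funext => i.
by rewrite nth_map_enum; congr v; apply: val_inj.
Qed.

Lemma cochain_of_eq k (a : 'Form[R]_k V) (b : seq V -> R) :
  homogeneous k b -> (forall v, a v = b [seq v i | i <- enum 'I_k]) ->
  cochain_of a = b.
Proof.
move=> hb ab; apply/funext => s; rewrite /cochain_of; case: eqP => [sk|/eqP/hb->//].
rewrite ab; congr b; apply: (@eq_from_nth _ 0) => [|i]; rewrite size_map_enum//.
by move=> ik; rewrite nth_map_enum.
Qed.

Lemma cochain_of_wedge k l (a : 'Form[R]_k V) (b : 'Form[R]_l V) :
  antisym (cochain_of a) -> antisym (cochain_of b) ->
  cochain_of (wedge a b) = shuffle (cochain_of a) (cochain_of b).
Proof.
move=> sa sb; apply: cochain_of_eq => [|v].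
  by apply: homogeneous_shuffle; exact: cochain_of_homogeneous.
have kl : (k <= k + l)%N by rewrite leq_addr.
have := sum_perm_shuffle v kl sa sb (@cochain_of_homogeneous _ a).
rewrite addKn => /(_ (@cochain_of_homogeneous _ b)) E.
rewrite /wedge; apply: (canLR (mulKf _)) => /=.
  by rewrite pnatr_eq0 muln_eq0 negb_or -!lt0n !fact_gt0.
rewrite -E; apply: eq_bigr => s _; congr (_ * (_ * _)).
  rewrite -cochain_ofE; congr cochain_of.
  apply: (@eq_from_nth _ 0) => [|i].
    by rewrite size_takel !size_map_enum.
  rewrite size_map_enum => ik.
  rewrite nth_take// !nth_map_enum ?(leq_trans ik)// => ikl.
  by congr (v (s _)); apply: val_inj.
rewrite -cochain_ofE; congr cochain_of.
apply: (@eq_from_nth _ 0) => [|i].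
  by rewrite size_drop !size_map_enum addKn.
rewrite size_map_enum => il; rewrite nth_drop !nth_map_enum.
  by rewrite ltn_add2l.
by move=> ikl; congr (v (s _)); apply: val_inj.
Qed.

Lemma cochain_of_form1 : cochain_of (@form1 R V) = @unit_cochain R V.
Proof. by apply/funext; case. Qed.

Lemma cochain_of_skew k (a : 'Form[R]_k V) : exterior_form a ->
  mlinear (cochain_of a) /\ antisym (cochain_of a).
Proof.
move=> [la aa].
have lh : mlinear (cochain_of a).
  move=> s x y z t; rewrite /cochain_of !size_cat /=; case: eqP => sz; last by ring.
  have sk : (size s < k)%N by rewrite -sz addnS ltnS leq_addr.
  have E u : (fun i : 'I_k => nth 0 (s ++ u :: t) i) =
     subst_arg (fun i : 'I_k => nth 0 (s ++ 0 :: t) i) (Ordinal sk) u.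
    apply/funext => i; rewrite /subst_arg -val_eqE /= !nth_cat.
    case: ltngtP => // si; first by rewrite -(subnSK si).
    by rewrite si subnn.
  by rewrite (E (_ + _)) (E x) (E y) la.
split=> // s x y t.
have rep u : cochain_of a (s ++ u :: u :: t) = 0.
  rewrite /cochain_of !size_cat /=; case: eqP => // sz.
  have s2 : ((size s).+1 < k)%N by rewrite -sz !addnS !ltnS leq_addr.
  have s1 : (size s < k)%N := ltnW s2.
  apply: (aa _ (Ordinal s1) (Ordinal s2)); first by rewrite -val_eqE neq_ltn ltnSn.
  by rewrite /= !nth_cat ltnn subnn ltnNge leqnSn /= subSnn.
have add s' u w t' : cochain_of a (s' ++ (u + w) :: t') =
    cochain_of a (s' ++ u :: t') + cochain_of a (s' ++ w :: t').
  by rewrite -{1}[u]scale1r lh mul1r.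
have add2 u v w : cochain_of a (s ++ u :: v + w :: t) =
    cochain_of a (s ++ u :: v :: t) + cochain_of a (s ++ u :: w :: t).
  by have := add (rcons s u) v w t; rewrite !cat_rcons.
have := rep (x + y); rewrite add !add2 !rep.
by rewrite add0r addr0 => /eqP; rewrite addr_eq0 => /eqP.
Qed.

End Bridge.

(** * Alternating cochains in finite dimension *)

Section FiniteDimension.
Variables (R : numFieldType) (V : lmodType R).
Implicit Types (a : seq V -> R) (s : seq V).

Lemma mlinear0 a s : mlinear a -> a (0 :: s) = 0.
Proof.
move=> la; have := la [::] 0 0 (-1) s; rewrite scaler0 addr0 /= => ->.
by rewrite mulN1r addNr.
Qed.

Lemma mlinear_sum a s r (z : 'I_r -> R) (x : 'I_r -> V) : mlinear a ->
  a (\sum_i z i *: x i :: s) = \sum_i z i * a (x i :: s).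
Proof.
move=> la; apply: (big_ind2 (fun u c => a (u :: s) = c)) => [|u c v d <- <-|i _].
- exact: mlinear0.
- by have := la [::] u v 1 s; rewrite scale1r mul1r.
- by have := la [::] (x i) 0 (z i) s; rewrite addr0 /= mlinear0// addr0.
Qed.

Variables (N : nat) (psi : {linear 'rV[R]_N -> V}).
Hypothesis psi_bij : bijective psi.

Lemma exists_kernel r (F : V -> 'rV[R]_r) : linear F -> (r < N)%N ->
  exists2 x, x != 0 & F x = 0.
Proof.
move=> lF rN.
pose A := \matrix_(i < N) F (psi (delta_mx 0 i)).
have : kermx A != 0.
  by rewrite -mxrank_eq0 mxrank_ker -lt0n subn_gt0 (leq_ltn_trans (rank_leq_col A)).
case/rowV0Pn => u /sub_kermxP uA u0; exists (psi u).
  by apply: contra u0 => /eqP pu; rewrite -(inj_eq (bij_inj psi_bij)) pu linear0.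
pose FL : {linear V -> 'rV[R]_r} := HB.pack F (GRing.isLinear.Build R V 'rV[R]_r _ F lF).
rewrite -[F _]/(FL (psi u)) (row_sum_delta u) !linear_sum -[RHS]uA mulmx_sum_row.
by apply: eq_bigr => i _; rewrite !linearZ /= rowK.
Qed.

(** More than [N] vectors satisfy a linear relation [\sum_i u_i s_i = 0] with
    some [u_j] nonzero.  Put the [j]-th vector in front and replace it by the
    relation: every term but the [j]-th repeats a vector, so
    [u_j * a s = 0] up to sign. *)
Lemma alternating_above_dim a s : mlinear a -> antisym a -> (N < size s)%N ->
  a s = 0.
Proof.
move=> la sa Ns; have [co coK psiK] := psi_bij.
pose A := \matrix_(i < size s) co (nth 0 s i).
have : kermx A != 0.
  by rewrite -mxrank_eq0 mxrank_ker -lt0n subn_gt0 (leq_ltn_trans (rank_leq_col A)).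
case/rowV0Pn => u /sub_kermxP uA /rV0Pn[j uj].
have rel : \sum_i u 0 i *: nth 0 s i = 0.
  rewrite -[RHS](linear0 psi) -[X in _ = psi X]uA mulmx_sum_row linear_sum; apply: eq_bigr => i _.
  by rewrite linearZ /= rowK psiK.
have := mlinear_sum (take j s ++ drop j.+1 s) (u 0) (fun i : 'I__ => nth 0 s i) la.
rewrite rel mlinear0// (bigD1 j)//= big1 => [|i ij].
  rewrite addr0 => /esym/eqP; rewrite mulf_eq0 (negPf uj) /= => /eqP a0.
  rewrite -[s in LHS](cat_take_drop j) (drop_nth 0)//.
  by rewrite antisym_front// a0 mulr0.
rewrite antisym_repeat ?mulr0// mem_cat.
have [ij'|ij'] := ltnP i j.
  by rewrite -(nth_take 0 ij') mem_nth// size_takel// ltnW.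
have {}ij' : (j.+1 <= i)%N by rewrite ltn_neqAle ij' eq_sym andbT.
rewrite -(subnKC ij') -nth_drop mem_nth ?orbT// size_drop.
by rewrite ltn_sub2r// (leq_ltn_trans ij').
Qed.

End FiniteDimension.

(** * Symplectic linear algebra *)

Section Symplectic.
Variables (R : numFieldType) (V : lmodType R) (w : seq V -> R).
Hypotheses (w_lin : mlinear w) (w_skew : antisym w) (w_deg : homogeneous 2 w).
Implicit Types (x y a b : V) (s xs : seq V).

Definition pairing x y := w [:: x; y].

Lemma pairingC x y : pairing x y = - pairing y x.
Proof. exact: (w_skew [::]). Qed.

Lemma pairing_self x : pairing x x = 0.
Proof. exact: (antisym_repeat w_skew (mem_head _ _)). Qed.

Lemma pairing_linl z x x' y : pairing (z *: x + x') y = z * pairing x y + pairing x' y.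
Proof. exact: (w_lin [::]). Qed.

Lemma pairing_linr z x y y' : pairing x (z *: y + y') = z * pairing x y + pairing x y'.
Proof. exact: (w_lin [:: x]). Qed.

Lemma pairing0r x : pairing x 0 = 0.
Proof. by rewrite pairingC [pairing 0 x](mlinear0 _ w_lin) oppr0. Qed.

Lemma pairingDr x y y' : pairing x (y + y') = pairing x y + pairing x y'.
Proof. by rewrite -{1}[y]scale1r pairing_linr mul1r. Qed.

Lemma pairingBr x y y' : pairing x (y - y') = pairing x y - pairing x y'.
Proof. by rewrite addrC -scaleN1r pairing_linr mulN1r addrC. Qed.

Lemma pairingBl x x' y : pairing (x - x') y = pairing x y - pairing x' y.
Proof. by rewrite addrC -scaleN1r pairing_linl mulN1r addrC. Qed.

Lemma pairingZr z x y : pairing x (z *: y) = z * pairing x y.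
Proof. by rewrite -[z *: y]addr0 pairing_linr pairing0r addr0. Qed.

(** The 1-form [- i_x w]; with the convention [i_X w = - df], [flat X] is [df]
    when [X] is the hamiltonian vector of [f]. *)
Definition flat x : seq V -> R := fun s => - w (x :: s).

Definition wedge_flat xs := foldr (fun x => shuffle (flat x)) (@unit_cochain R V) xs.

Lemma wedge_flat_cons x xs :
  wedge_flat (x :: xs) = shuffle (flat x) (wedge_flat xs).
Proof. by []. Qed.

Definition power m := iter m (shuffle w) (@unit_cochain R V).

Definition orthogonal x xs := forall y, y \in xs -> pairing x y = 0.

Lemma flat_homogeneous x : homogeneous 1 (flat x).
Proof. by move=> s s1; rewrite /flat w_deg ?oppr0. Qed.

Lemma flat_linear z x y : flat (z *: x + y) = fun s => z * flat x s + flat y s.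
Proof. by apply/funext => s; rewrite /flat (w_lin [::]) /=; ring. Qed.

Lemma flat_grading x : grading (flat x) = fun s => -1 * flat x s.
Proof. by rewrite (homogeneous_grading (@flat_homogeneous x)) expr1. Qed.

Lemma mlinear_flat x : mlinear (flat x).
Proof. by move=> s y y' z t; rewrite /flat (w_lin (x :: s)); ring. Qed.

Lemma antisym_flat x : antisym (flat x).
Proof. by move=> s y y' t; rewrite /flat (w_skew (x :: s)). Qed.

Lemma iprod_flat x y : iprod y (flat x) = fun s => pairing y x * unit_cochain s.
Proof.
apply/funext => -[|z s]; rewrite /iprod /flat /unit_cochain /=.
  by rewrite mulr1 pairingC.
by rewrite w_deg ?oppr0 ?mulr0.
Qed.

Lemma iprod_omega x : iprod x w = fun s => -1 * flat x s.
Proof. by apply/funext => s; rewrite /flat mulN1r opprK. Qed.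

Lemma wedge_flat_homogeneous xs : homogeneous (size xs) (wedge_flat xs).
Proof.
elim: xs => [|x xs IH] /=; first by case.
by apply: (@homogeneous_shuffle _ _ 1); [exact: flat_homogeneous|].
Qed.

Lemma power_homogeneous m : homogeneous m.*2 (power m).
Proof.
elim: m => [|m IH]; first by case.
by apply: (@homogeneous_shuffle _ _ 2).
Qed.

Lemma mlinear_unit : mlinear (@unit_cochain R V).
Proof. by case=> [|u s] x y z t; rewrite /unit_cochain /=; ring. Qed.

Lemma antisym_unit : antisym (@unit_cochain R V).
Proof. by case=> [|u s] x y t; rewrite /unit_cochain /= oppr0. Qed.

Lemma mlinear_wedge_flat xs : mlinear (wedge_flat xs).
Proof.
elim: xs => [|x xs IH]; first exact: mlinear_unit.
by apply: mlinear_shuffle => //; exact: mlinear_flat.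
Qed.

Lemma antisym_wedge_flat xs : antisym (wedge_flat xs).
Proof.
elim: xs => [|x xs IH]; first exact: antisym_unit.
by apply: antisym_shuffle => //; exact: antisym_flat.
Qed.

Lemma mlinear_power m : mlinear (power m).
Proof. by elim: m => [|m IH]; [exact: mlinear_unit|exact: mlinear_shuffle]. Qed.

Lemma antisym_power m : antisym (power m).
Proof. by elim: m => [|m IH]; [exact: antisym_unit|exact: antisym_shuffle]. Qed.

(** [w] has even degree, so it commutes with everything and the antiderivation
    rule differentiates its powers as usual. *)
Lemma iprod_power x m :
  iprod x (power m.+1) = fun s => - m.+1%:R * shuffle (flat x) (power m) s.
Proof.
have e2 : (-1) ^+ 2 = 1 :> R by rewrite sqrrN expr1n.
have gw : grading w = fun s => (-1) ^+ 2 * w s := homogeneous_grading w_deg.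
have gf : grading (flat x) = fun s => (-1) ^+ 1 * flat x s.
  exact: homogeneous_grading (@flat_homogeneous x).
have wf : shuffle w (flat x) = shuffle (flat x) w.
  by rewrite (shuffleC gw gf); apply/funext => s; rewrite e2 mul1r.
elim: m => [|m IH]; rewrite [power _.+1]/= -/(power _) iprod_shuffle iprod_omega.
  rewrite shuffleZl [iprod x (power 0)](_ : _ = fun=> 0) ?shuffle0r.
    by apply/funext => s; rewrite addr0.
  by apply: homogeneous0_iprod; case.
rewrite shuffleZl IH shuffleZr gw shuffleZl -(shuffleA w) wf shuffleA.
apply/funext => s; rewrite -[shuffle w (power m)]/(power m.+1) [in RHS]mulrSr e2.
by ring.
Qed.

Lemma iprod_wedge_flat a xs c : orthogonal a xs ->
  iprod a (shuffle (wedge_flat xs) c) =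
  fun s => (-1) ^+ size xs * shuffle (wedge_flat xs) (iprod a c) s.
Proof.
elim: xs => [_|x xs IH ax] /=.
  by rewrite !shuffle1l; apply/funext => s; rewrite mul1r.
rewrite shuffleA iprod_shuffle iprod_flat ax ?mem_head//.
rewrite IH => [|y yx]; last by apply: ax; rewrite inE yx orbT.
rewrite flat_grading !shuffleZl shuffleZr shuffleA; apply/funext => s.
by rewrite exprS; ring.
Qed.

Lemma flatC x y c :
  shuffle (flat x) (shuffle (flat y) c) =
  fun s => -1 * shuffle (flat y) (shuffle (flat x) c) s.
Proof.
have gf z : grading (flat z) = fun s => (-1) ^+ 1 * flat z s.
  exact: homogeneous_grading (@flat_homogeneous z).
by rewrite -!shuffleA (shuffleC (gf x) (gf y)) shuffleZl expr1.
Qed.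

Lemma flat_wedge_repeat x xs c :
  x \in xs -> shuffle (flat x) (shuffle (wedge_flat xs) c) = fun=> 0.
Proof.
elim: xs => //= y xs IH; rewrite inE shuffleA flatC => /orP[/eqP <-|/IH ->].
  have := flatC x x (shuffle (wedge_flat xs) c) => E.
  apply/funext => s; have /eqP := congr1 (@^~ s) E; rewrite mulN1r -addr_eq0.
  by rewrite -mulr2n mulrn_eq0 /= => /eqP ->; rewrite oppr0.
by rewrite shuffle0r; apply/funext => s; rewrite mulr0.
Qed.

Lemma flat_span_wedge r (z : 'I_r -> R) (x : 'I_r -> V) xs c :
  (forall i, x i \in xs) ->
  shuffle (flat (\sum_i z i *: x i)) (shuffle (wedge_flat xs) c) = fun=> 0.
Proof.
move=> xxs; apply: (big_ind (fun u => shuffle (flat u) _ = fun=> 0)).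
- rewrite [flat 0](_ : _ = fun=> 0) ?shuffle0l//.
  by apply/funext => s; rewrite /flat mlinear0 ?oppr0.
- move=> u v u0 v0; rewrite -[u]scale1r flat_linear shuffle_linearl u0 v0.
  by apply/funext => s; rewrite mulr0 addr0.
- move=> i _; rewrite -[_ *: _]addr0 flat_linear shuffle_linearl flat_wedge_repeat//.
  rewrite [flat 0](_ : _ = fun=> 0) ?shuffle0l//.
    by apply/funext => s; rewrite mulr0 addr0.
  by apply/funext => s; rewrite /flat mlinear0 ?oppr0.
Qed.

Variables (N : nat) (psi : {linear 'rV[R]_N -> V}).
Hypothesis psi_bij : bijective psi.

(** The heart of the matter.  The form [b^ /\ xs^ /\ w^(m+1)], where [^]
    denotes [flat], has degree [N + 1] and so vanishes; contract it with [a].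
    Since [a] is orthogonal to [xs], the contraction ignores the factors
    [xs^]; on [b^] it yields [pairing a b] and on the power of [w] it yields
    [- (m+1) a^ /\ w^m]. *)
Lemma wedge_power_identity a b xs m s :
  (size xs + m.+1.*2 = N)%N -> ~~ odd (size xs) -> size s = N ->
  orthogonal a xs ->
  m.+1%:R * shuffle (flat a) (shuffle (flat b) (shuffle (wedge_flat xs) (power m))) s =
  pairing a b * shuffle (wedge_flat xs) (power m.+1) s.
Proof.
move=> Nxs exs Ns axs.
have xsa c : shuffle (wedge_flat xs) (shuffle (flat a) c) =
    shuffle (flat a) (shuffle (wedge_flat xs) c).
  rewrite -!shuffleA (shuffleC (homogeneous_grading (@wedge_flat_homogeneous xs))
    (homogeneous_grading (@flat_homogeneous a))).
  congr shuffle; apply/funext => t.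
  by rewrite muln1 -signr_odd (negPf exs) mul1r.
pose Z := shuffle (flat b) (shuffle (wedge_flat xs) (power m.+1)).
have lZ : mlinear Z.
  apply: mlinear_shuffle; first exact: mlinear_flat.
  by apply: mlinear_shuffle; [exact: mlinear_wedge_flat|exact: mlinear_power].
have sZ : antisym Z.
  apply: antisym_shuffle; first exact: antisym_flat.
  by apply: antisym_shuffle; [exact: antisym_wedge_flat|exact: antisym_power].
have : iprod a Z s = 0.
  by rewrite /iprod; apply: (alternating_above_dim psi_bij) => //; rewrite /= Ns.
rewrite /Z iprod_shuffle iprod_flat flat_grading shuffleZl shuffle1l shuffleZl.
rewrite iprod_wedge_flat// iprod_power !shuffleZr -signr_odd (negPf exs) expr0.
rewrite xsa flatC => /eqP; rewrite addrC addr_eq0 => /eqP E.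
by rewrite -[RHS]opprK -E; ring.
Qed.

Section Projection.
Variables (r : nat) (x : 'I_r -> V).

Definition gram : 'M[R]_r := \matrix_(i, j) pairing (x i) (x j).

(** The projection onto the span of the [x i] along its [w]-orthogonal
    complement, when the Gram matrix is invertible.  Applied to the
    hamiltonian vector of [f], it is the correction that turns the Poisson
    bracket into the Dirac bracket. *)
Definition gram_proj y : V :=
  \sum_i (\sum_j pairing y (x j) * invmx gram j i) *: x i.

Lemma pairing_gram_proj y b : pairing (gram_proj y) b =
  \sum_i \sum_j pairing y (x i) * invmx gram i j * pairing (x j) b.
Proof.
rewrite exchange_big /= [LHS]mlinear_sum//.
by apply: eq_bigr => i _; rewrite mulr_suml.
Qed.

Lemma gram_proj_orthogonal y : gram \in unitmx ->
  orthogonal (y - gram_proj y) [seq x i | i <- enum 'I_r].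
Proof.
move=> uG b /mapP[l _ ->]; apply/eqP; rewrite pairingBl subr_eq0 pairing_gram_proj.
pose u := \row_i pairing y (x i).
have := congr1 (fun A : 'rV_r => A 0 l) (mulmxKV uG u).
rewrite -mulmxA !mxE => <-; apply/eqP; apply: eq_bigr => i _.
rewrite !mxE mulr_sumr; apply: eq_bigr => j _.
by rewrite !mxE mulrA.
Qed.

End Projection.

(** Reduction to the orthogonal case: subtracting from [a] its projection on
    the span of the [x i] does not change [a^ /\ x_1^ /\ ... /\ x_r^]. *)
Lemma dirac_identity r (x : 'I_r -> V) a b m s :
  gram x \in unitmx -> (r + m.+1.*2 = N)%N -> ~~ odd r -> size s = N ->
  m.+1%:R * shuffle (flat a) (shuffle (flat b)
      (shuffle (wedge_flat [seq x i | i <- enum 'I_r]) (power m))) s =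
  pairing (a - gram_proj x a) b *
    shuffle (wedge_flat [seq x i | i <- enum 'I_r]) (power m.+1) s.
Proof.
move=> uG Nxs exs Ns; set xs := [seq _ | _ <- _].
have sxs : size xs = r := size_map_enum x.
have axs := gram_proj_orthogonal a uG.
rewrite -(wedge_power_identity b _ _ Ns axs) ?sxs//; congr (_ * _).
rewrite [a - _]addrC -scaleN1r flat_linear shuffle_linearl.
rewrite [X in _ = -1 * X + _](_ : _ = 0) ?mulr0 ?add0r//.
rewrite flatC flat_span_wedge ?shuffle0r ?mulr0// => i.
by apply: map_f; rewrite mem_enum.
Qed.

Hypothesis w_nondeg : forall x, (forall y, pairing x y = 0) -> x = 0.

Lemma flat_surjective (l : V -> R) : (forall z x y, l (z *: x + y) = z * l x + l y) ->
  exists x, forall y, l y = - pairing x y.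
Proof.
move=> ll; have [co coK psiK] := psi_bij.
pose A : 'M[R]_N := \matrix_(i, j) pairing (psi (delta_mx 0 i)) (psi (delta_mx 0 j)).
have lpsi (f : V -> R) : (forall z x y, f (z *: x + y) = z * f x + f y) ->
   forall u, f (psi u) = \sum_i u 0 i * f (psi (delta_mx 0 i)).
  move=> lf u; have f0 : f 0 = 0.
    by have := lf (-1) 0 0; rewrite scaler0 addr0 mulN1r addNr.
  rewrite {1}(row_sum_delta u) linear_sum.
  apply: (big_ind2 (fun u c => f u = c)) => [//|v c v' d <- <-|i _].
    by rewrite -{1}[v]scale1r lf mul1r.
  by rewrite linearZ /= -[_ *: _]addr0 lf f0 addr0.
have pl y : forall z x x', pairing (z *: x + x') y = z * pairing x y + pairing x' y.
  by move=> z x x'; exact: pairing_linl.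
have Au : A \in unitmx.
  rewrite -row_free_unit -kermx_eq0; apply/eqP/row_matrixP => i.
  rewrite row0; move: (row i _) (row_sub i (kermx A)) => u /sub_kermxP uA.
  suff /(congr1 co) : psi u = 0 by rewrite coK -(linear0 psi) coK.
  apply: w_nondeg => y; rewrite pairingC -[y]psiK.
  rewrite (lpsi (fun y => pairing y (psi u)))// big1 ?oppr0// => j _.
  rewrite pairingC (lpsi (fun x => pairing x _))//.
  have := congr1 (fun M : 'rV_N => M 0 j) uA; rewrite !mxE => E.
  rewrite (eq_bigr (fun i => u 0 i * A i j)) ?E ?oppr0 ?mulr0// => k _.
  by rewrite mxE.
pose c := \row_j - l (psi (delta_mx 0 j)).
exists (psi (c *m invmx A)) => y.
have E j : pairing (psi (c *m invmx A)) (psi (delta_mx 0 j)) = c 0 j.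
  rewrite (lpsi (fun x => pairing x _))// -[in RHS](mulmxKV Au c) [RHS]mxE.
  by apply: eq_bigr => i _; rewrite [A i j]mxE.
rewrite -pairingC -[y]psiK lpsi// (lpsi (fun y => pairing y _))//.
by apply: eq_bigr => j _; rewrite pairingC E mxE opprK.
Qed.

(** The span of [xs] and its orthogonal complement generate the space.  The
    component [t] is characterised by its orthogonality to the complement,
    which spares the coefficients of a combination of [xs]. *)
Definition splits xs := forall y, exists t,
  (forall a, orthogonal a xs -> pairing a t = 0) /\ orthogonal (y - t) xs.

Lemma gram_splits r (x : 'I_r -> V) : gram x \in unitmx ->
  splits [seq x i | i <- enum 'I_r].
Proof.
move=> uG y; exists (gram_proj x y); split; last exact: gram_proj_orthogonal.
move=> a ax; rewrite pairingC [pairing _ _]mlinear_sum// big1 ?oppr0// => i _.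
by rewrite -[w _]/(pairing _ _) pairingC ax ?oppr0 ?mulr0// map_f// mem_enum.
Qed.

Lemma exists_orthogonal xs : (size xs < N)%N -> exists2 a, a != 0 & orthogonal a xs.
Proof.
move=> sN; pose F a := \row_(i < size xs) pairing a (nth 0 xs i).
have lF : linear F by move=> z x y; apply/rowP => i; rewrite !mxE pairing_linl.
have [a a0 Fa] := exists_kernel psi_bij lF sN.
exists a => // y yxs; have ixs : (index y xs < size xs)%N by rewrite index_mem.
have := congr1 (fun M : 'rV_(size xs) => M 0 (Ordinal ixs)) Fa.
by rewrite !mxE /= nth_index.
Qed.

Lemma orthogonal_cons a x xs :
  orthogonal a (x :: xs) <-> pairing a x = 0 /\ orthogonal a xs.
Proof.
split=> [axs|[ax axs] y].
  by split=> [|y yxs]; apply: axs; rewrite ?mem_head// inE yxs orbT.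
by rewrite inE => /orP[/eqP ->//|]; exact: axs.
Qed.

(** Enlarge [xs] by two vectors [a], [b] of its orthogonal complement with
    [pairing a b != 0]; the hypotheses persist, and by [wedge_power_identity]
    the form attached to [a, b & xs] and [w^m] is a multiple of the one
    attached to [xs] and [w^(m+1)].  Thus powers of [w] are traded for
    1-forms until none is left. *)
Lemma wedge_power_neq0 m xs : (size xs + m.*2 = N)%N -> ~~ odd (size xs) ->
  splits xs -> (exists s, wedge_flat xs s != 0) ->
  exists s, shuffle (wedge_flat xs) (power m) s != 0.
Proof.
elim: m xs => [|m IH] xs Nxs exs sxs [s0 s0P].
  by exists s0; rewrite shuffle1r.
have [|a a0 axs] := @exists_orthogonal xs; first by rewrite -Nxs; lia.
have [b0 ab0] : exists b, pairing a b != 0.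
  apply/not_existsP => H; move/eqP: a0; apply; apply: w_nondeg => y.
  by have /negP := H y; rewrite negbK => /eqP.
have [t [tP bxs]] := sxs b0; pose b := b0 - t.
have ab : pairing a b != 0 by rewrite pairingBr (tP _ axs) subr0.
have ba : pairing b a != 0 by rewrite pairingC oppr_eq0.
have [||||s sP] := IH [:: a, b & xs].
- by rewrite /= -Nxs; lia.
- by rewrite /= negbK.
- move=> y; have [t' [t'P yxs]] := sxs y; pose y' := y - t'.
  pose u := (pairing y' b / pairing a b) *: a + (pairing y' a / pairing b a) *: b.
  (* [u] is the component of [y'] in the plane spanned by [a] and [b]. *)
  exists (t' + u); split=> [c /orthogonal_cons[ca /orthogonal_cons[cb cxs]]|].
    by rewrite pairingDr t'P// add0r /u pairingDr !pairingZr ca cb !mulr0 addr0.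
  rewrite opprD addrA -/y'.
  have pul c : pairing u c = (pairing y' b / pairing a b) * pairing a c +
     (pairing y' a / pairing b a) * pairing b c.
    rewrite /u pairing_linl; congr (_ + _).
    by rewrite pairingC pairingZr -mulrN -pairingC.
  apply/orthogonal_cons; split.
    by rewrite pairingBl pul pairing_self mulr0 add0r divfK// subrr.
  apply/orthogonal_cons; split.
    by rewrite pairingBl pul pairing_self mulr0 addr0 divfK// subrr.
  move=> c cxs; rewrite pairingBl pul (yxs c)// (axs c)// (bxs c)//; ring.
- (* [b] is seen only by [a^], and [a] only by [b^]. *)
  exists [:: b, a & s0].
  have ip c ys : orthogonal c ys -> iprod c (wedge_flat ys) = fun=> 0.
    move=> cys; rewrite -[wedge_flat ys]shuffle1r iprod_wedge_flat//.
    rewrite [iprod _ (@unit_cochain R V)]homogeneous0_iprod; last by case.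
    by rewrite shuffle0r; apply/funext => ?; rewrite mulr0.
  rewrite -[X in X != _]/(iprod b (wedge_flat [:: a, b & xs]) (a :: s0)).
  rewrite wedge_flat_cons iprod_shuffle ip; last first.
    by apply/orthogonal_cons; split=> //; exact: pairing_self.
  rewrite shuffle0r addr0 iprod_flat shuffleZl shuffle1l.
  rewrite -[X in _ * X]/(iprod a (wedge_flat (b :: xs)) s0) wedge_flat_cons.
  rewrite iprod_shuffle ip//.
  by rewrite shuffle0r addr0 iprod_flat shuffleZl shuffle1l !mulf_neq0.
have sN : size s = N.
  apply/eqP; apply: contraR sP => sN; apply/eqP.
  apply: homogeneous_shuffle (@wedge_flat_homogeneous _) (@power_homogeneous m) _ _.
  by rewrite /=; apply: contra sN => /eqP ->; apply/eqP; rewrite -Nxs; lia.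
exists s; have E := wedge_power_identity b Nxs exs sN axs.
have : m.+1%:R * shuffle (wedge_flat [:: a, b & xs]) (power m) s != 0.
  by rewrite mulf_neq0// pnatr_eq0.
by rewrite /= !shuffleA E mulf_eq0 negb_or => /andP[].
Qed.

End Symplectic.

(** * Forms built from a 2-form, as cochains *)

Section FormsAsCochains.
Variables (R : realType) (V : lmodType R).

Lemma cast_formE k l (e : k = l) (a : 'Form[R]_k V) v :
  cast_form e a v = cochain_of a [seq v i | i <- enum 'I_l].
Proof.
case: l / e v => v; rewrite cochain_ofE /cast_form; congr a.
by apply/funext => i; rewrite cast_ord_id.
Qed.

Lemma cochain_of_scale k z (a : 'Form[R]_k V) :
  cochain_of (scale_form z a) = fun s => z * cochain_of a s.
Proof.
by apply/funext => s; rewrite /cochain_of; case: ifP; rewrite ?mulr0.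
Qed.

Variable (w : 'Form[R]_2 V).
Hypothesis w_ext : exterior_form w.

Lemma cochain_of_wedge_pow m :
  cochain_of (wedge_pow w m) = power (cochain_of w) m.
Proof.
have [wl ws] := cochain_of_skew w_ext.
elim: m => [|m IH]; first exact: cochain_of_form1.
by rewrite /= (@cochain_of_wedge _ _ 2 m.*2)// IH//; exact: antisym_power.
Qed.

Lemma cochain_of_wedge_list r (a : 'I_r -> 'Form[R]_1 V) (x : 'I_r -> V) :
  (forall i, cochain_of (a i) = flat (cochain_of w) (x i)) ->
  cochain_of (wedge_list a) =
  wedge_flat (cochain_of w) [seq x i | i <- enum 'I_r].
Proof.
have [wl ws] := cochain_of_skew w_ext.
elim: r a x => [|r IH] a x ax.
  rewrite (_ : [seq x i | i <- _] = [::]); first exact: cochain_of_form1.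
  by apply: size0nil; rewrite size_map_enum.
rewrite enum_ordSl /= -map_comp (@cochain_of_wedge _ _ 1 r) ?ax.
- by rewrite (IH _ (fun i => x (lift ord0 i))).
- exact: antisym_flat.
- by rewrite (IH _ (fun i => x (lift ord0 i)))//; exact: antisym_wedge_flat.
Qed.

Lemma contractE (x : V) (v : 'I_1 -> V) : Defs.contract x w v = pairing (cochain_of w) x (v ord0).
Proof.
rewrite /pairing /cochain_of /=; congr w; apply/funext => i.
case: unliftP => [j|] -> //=.
by rewrite (ord1 j).
Qed.

End FormsAsCochains.

(** * Tangent spaces and the Dirac bracket *)

Section TangentSpace.
Variables (R : realType) (m : nat) (M : manifold R m) (p : M).

Lemma val_coord_vector c u : chart_at p c ->
  (coord_vector c p u : _ -> _) = coord_family c p u.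
Proof.
move=> pc; rewrite /coord_vector insubdK//.
by apply/asboolP; exact: coord_family_tangent.
Qed.

(** The change of coordinates from a chart to itself is the identity near the
    point, so its differential is the identity. *)
Lemma coord_vector_self c u : chart_at p c -> coord_vector c p u c = u.
Proof.
move=> pc; rewrite val_coord_vector// /coord_family asboolT//.
have [ac cp] := pc.
have dcc : differentiable (c \o chart_inv c) (c p).
  by have /(_ [::] (c p)) := atlas_compatible ac ac; apply; exists p.
rewrite -deriveE//.
have -> : 'D_u (c \o chart_inv c) (c p) = 'D_u id (c p).
  apply: near_eq_derive.
  have : nbhs (c p) (c @` chart_dom c).
    by apply: open_nbhs_nbhs; split; [exact: chart_img_open|exists p].
  by apply: filterS => _ [q cq <-] /=; rewrite chart_mapK.
exact: derive_id.
Qed.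

Lemma coord_vector_linear c : chart_at p c -> linear (coord_vector c p).
Proof.
move=> pc z x y; apply: val_inj => /=.
rewrite -[RHS]/(z *: (coord_vector c p x : _ -> _) + (coord_vector c p y : _ -> _)).
rewrite !val_coord_vector//; apply/funext => c'.
rewrite -[RHS]/(z *: coord_family c p x c' + coord_family c p y c').
rewrite /coord_family; case: asboolP => _; first by rewrite linearP.
by rewrite scaler0 addr0.
Qed.

Lemma coord_vector_bij c : chart_at p c -> bijective (coord_vector c p).
Proof.
move=> pc; exists (fun v : tangent p => v c) => [u|v].
  exact: coord_vector_self.
apply: val_inj; rewrite /= val_coord_vector//; apply/funext => c'.
have /asboolP[v0 vJ] := components_tangent v.
rewrite /coord_family; case: asboolP => pc'; first by rewrite (vJ c c').
by rewrite v0.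
Qed.

Lemma pick_chartP : chart_at p (pick_chart p).
Proof. exact: projT2 (cid _). Qed.

Lemma dfun_linear (f : M -> R) z (x y : tangent p) :
  dfun f p (fun=> z *: x + y) = z * dfun f p (fun=> x) + dfun f p (fun=> y).
Proof.
rewrite /dfun.
rewrite -[(z *: x + y : tangent p) _]/(z *: x (pick_chart p) + y (pick_chart p)).
by rewrite linearP.
Qed.

End TangentSpace.

Section Pointwise.
Variables (R : realType) (n : nat) (M : symplectic_manifold R n) (p : M).

Let w := cochain_of (omega M p).

Lemma omega_mlinear : mlinear w.
Proof. by have [] := cochain_of_skew (dform_exterior (omega M) p). Qed.

Lemma omega_antisym : antisym w.
Proof. by have [] := cochain_of_skew (dform_exterior (omega M) p). Qed.

Lemma omega_homogeneous : homogeneous 2 w.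
Proof. exact: cochain_of_homogeneous. Qed.

Lemma omega_pairing_nondegenerate x : (forall y, pairing w x y = 0) -> x = 0.
Proof.
by move=> x0; apply: (@omega_nondegenerate _ _ M p) => v; rewrite contractE x0.
Qed.

Definition tangent_coords : {linear 'rV[R]_n.*2 -> tangent p} :=
  HB.pack (coord_vector (pick_chart p) p)
    (GRing.isLinear.Build R 'rV[R]_n.*2 (tangent p) _ _
       (coord_vector_linear (pick_chartP p))).

Lemma tangent_coords_bij : bijective tangent_coords.
Proof. exact: coord_vector_bij (pick_chartP p). Qed.

(** Nondegeneracy in finite dimension makes [flat] surjective, so the
    hamiltonian vector does solve its defining equation. *)
Lemma hamiltonianP (f : M -> R) y :
  dfun f p (fun=> y) = - pairing w (hamiltonian f p) y.
Proof.
have [X XP] := flat_surjective omega_mlinear omega_antisym tangent_coords_bij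
  omega_pairing_nondegenerate (dfun_linear (p := p) f).
have : Defs.contract (hamiltonian f p) (omega M p) = (fun v => - dfun f p v).
  apply: (@xgetPex _ 0 [set X : tangent p |
    Defs.contract X (omega M p) = (fun v => - dfun f p v)]).
  exists X; apply/funext => v; rewrite contractE.
  by rewrite -[dfun f p v]/(dfun f p (fun=> v ord0)) XP opprK.
by move=> /(congr1 (@^~ (fun=> y))); rewrite contractE => ->; rewrite opprK.
Qed.

Lemma cochain_of_dfun (f : M -> R) :
  cochain_of (dfun f p) = flat w (hamiltonian f p).
Proof.
apply: cochain_of_eq => [|v]; first exact: flat_homogeneous omega_homogeneous _.
rewrite -[dfun f p v]/(dfun f p (fun=> v ord0)) hamiltonianP.
by rewrite enum_ordSl (size0nil (size_enum_ord 0)).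
Qed.

Lemma poisson_bracketE (f g : M -> R) :
  poisson_bracket f g p = pairing w (hamiltonian f p) (hamiltonian g p).
Proof.
by rewrite /poisson_bracket hamiltonianP -pairingC//; exact: omega_antisym.
Qed.

Variables (k : nat) (chi : 'I_(k.*2) -> smooth_fun M).
Let X i := hamiltonian (chi i) p.

Lemma poisson_matrixE : poisson_matrix chi p = gram w X.
Proof. by apply/matrixP => i j; rewrite !mxE poisson_bracketE. Qed.

Lemma dirac_bracketE (f g : smooth_fun M) : dirac_bracket chi f g p =
  pairing w (hamiltonian f p - gram_proj w X (hamiltonian f p)) (hamiltonian g p).
Proof.
rewrite pairingBl; last exact: omega_mlinear.
rewrite pairing_gram_proj; last exact: omega_mlinear.
rewrite /dirac_bracket poisson_bracketE poisson_matrixE; congr (_ - _).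
by apply: eq_bigr => i _; apply: eq_bigr => j _; rewrite !poisson_bracketE.
Qed.

Lemma cochain_of_d_list :
  cochain_of (d_list chi p) = wedge_flat w [seq X i | i <- enum 'I_(k.*2)].
Proof.
apply: cochain_of_wedge_list => [|i]; first exact: dform_exterior.
exact: cochain_of_dfun.
Qed.

Lemma cochain_of_constraint_volume m :
  cochain_of (wedge (d_list chi p) (wedge_pow (omega M p) m)) =
  shuffle (wedge_flat w [seq X i | i <- enum 'I_(k.*2)]) (power w m).
Proof.
have o := dform_exterior (omega M) p.
have [ol oa] := cochain_of_skew o.
rewrite cochain_of_wedge ?cochain_of_d_list ?cochain_of_wedge_pow//.
  exact: antisym_wedge_flat.
exact: antisym_power.
Qed.

Lemma cochain_of_constraint_bracket (f g : smooth_fun M) m :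
  cochain_of (wedge (wedge (wedge (dfun f p) (dfun g p)) (d_list chi p))
               (wedge_pow (omega M p) m)) =
  shuffle (flat w (hamiltonian f p)) (shuffle (flat w (hamiltonian g p))
    (shuffle (wedge_flat w [seq X i | i <- enum 'I_(k.*2)]) (power w m))).
Proof.
have o := dform_exterior (omega M) p.
have [ol oa] := cochain_of_skew o.
have af (h : M -> R) : antisym (cochain_of (dfun h p)).
  by rewrite cochain_of_dfun; exact: antisym_flat.
have ad : antisym (cochain_of (d_list chi p)).
  by rewrite cochain_of_d_list; exact: antisym_wedge_flat.
have aw : antisym (cochain_of (wedge_pow (omega M p) m)).
  by rewrite cochain_of_wedge_pow//; exact: antisym_power.
have a2 : antisym (cochain_of (wedge (dfun f p) (dfun g p))).
  by rewrite cochain_of_wedge//; exact: antisym_shuffle.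
have a3 : antisym
    (cochain_of (wedge (wedge (dfun f p) (dfun g p)) (d_list chi p))).
  by rewrite cochain_of_wedge//; exact: antisym_shuffle.
rewrite (cochain_of_wedge a3 aw) (cochain_of_wedge a2 ad).
rewrite (cochain_of_wedge (af f) (af g)) !shuffleA !cochain_of_dfun cochain_of_d_list.
by rewrite cochain_of_wedge_pow.
Qed.

End Pointwise.

Theorem theorem3 (R : realType) (n k : nat) (M : symplectic_manifold R n)
    (hk : (1 <= k <= n - 1)%N) (chi : 'I_(k.*2) -> smooth_fun M)
    (hindep : forall p : M, d_list chi p <> (fun=> 0))
    (hdet : forall p : M, \det (poisson_matrix chi p) != 0) :
  (forall f g : smooth_fun M, dirac_equation hk chi f g (dirac_bracket chi f g)) /\
  (forall B : smooth_fun M -> smooth_fun M -> M -> R,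
     (forall f g : smooth_fun M, dirac_equation hk chi f g (B f g)) ->
     forall (f g : smooth_fun M) (p : M), B f g p = dirac_bracket chi f g p).
Proof.
have gramU p : gram (cochain_of (omega M p))
    (fun i => hamiltonian (chi i) p) \in unitmx.
  by rewrite -poisson_matrixE unitmxE unitfE hdet.
have existence f g : dirac_equation hk chi f g (dirac_bracket chi f g).
  move=> p; apply/funext => v; rewrite cast_formE cochain_of_scale /scale_form.
  rewrite cochain_of_constraint_bracket -[X in _ = _ * X]cochain_ofE.
  rewrite cochain_of_constraint_volume dirac_bracketE; set s := [seq v i | i <- _].
  have sz : size s = n.*2 by rewrite size_map_enum; lia.
  have [m mk] : exists m, (n - k = m.+1)%N by exists (n - k - 1)%N; lia.
  rewrite mk subSS subn0.
  have := dirac_identity (@omega_mlinear _ _ M p) (@omega_antisym _ _ M p)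
    (@omega_homogeneous _ _ M p) (@tangent_coords_bij _ _ M p) _ _ (gramU p).
  by apply; rewrite ?odd_double//; lia.
(* Uniqueness: the coefficient of the bracket on the right is not zero. *)
split=> // B BP f g p.
have [s sP] : exists s, shuffle (wedge_flat (cochain_of (omega M p))
    [seq hamiltonian (chi i) p | i <- enum 'I_(k.*2)])
    (power (cochain_of (omega M p)) (n - k)) s != 0.
  apply: (wedge_power_neq0 (@omega_mlinear _ _ M p) (@omega_antisym _ _ M p)
    (@omega_homogeneous _ _ M p) (@tangent_coords_bij _ _ M p)) => //.
  - exact: omega_pairing_nondegenerate.
  - by rewrite size_map_enum; lia.
  - by rewrite size_map_enum odd_double.
  - apply: gram_splits (gramU p); [exact: omega_mlinear|exact: omega_antisym].
  - apply/not_existsP => H; apply: (hindep p); apply/funext => v.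
    rewrite -cochain_ofE cochain_of_d_list; apply/eqP/negPn/negP; exact: H.
move: sP; rewrite -cochain_of_constraint_volume /cochain_of.
case: ifP => _; last by rewrite eqxx.
set v := (fun i => _) => vP.
have := congr1 (@^~ v) (etrans (esym (BP f g p)) (existence f g p)).
by rewrite /scale_form => /(mulIf vP).
Qed.
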